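(* Let $\mathbf{C}$ be a topos (with chosen pushouts). Then the data $\mathbf{MonSp(Csp(C))}$, whose $0$-cells are the objects of $\mathbf{C}$, whose $1$-cells $X \to Y$ are the cospans $X \to S \leftarrow Y$ in $\mathbf{C}$, and whose $2$-cells are isomorphism classes of spans of cospans in $\mathbf{C}$ with both legs monic, equipped with the vertical composition, horizontal composition, identities, associators and unitors described in the context, is a bicategory.
   Context: Topos means elementary topos. $\mathbf{C}$ is a topos with a choice of pushouts; $U +_V W$ denotes the (chosen) pushout of a span $U \leftarrow V \to W$, and $U\times_V W$ denotes a pullback of a cospan $U \to V \leftarrow W$. Spans of cospans. Given two cospans $X \to L \leftarrow Y$ and $X \to S \leftarrow Y$ in $\mathbf{C}$, a span of cospans from $L$ to $S$ is an object $S'$ with maps $X \to S' \leftarrow Y$ and maps (its legs) $L \leftarrow S' \to S$ such that both legs commute with the maps from $X$ and from $Y$. A morphism from a span of cospans $S'_1$ to a span of cospans $S'_2$ (both from $L$ to $S$) is a $\mathbf{C}$-morphism $S'_1 \to S'_2$ commuting with the maps from $X$ and $Y$ and with the legs to $L$ and $S$; it is an isomorphism if the underlying $\mathbf{C}$-morphism is. The structure of $\mathbf{MonSp(Csp(C))}$: - $0$-cells: objects of $\mathbf{C}$. - Hom-categories: for $0$-cells $X,Y$, the objects ($1$-cells) are cospans $X \to S \leftarrow Y$ in $\mathbf{C}$; the morphisms ($2$-cells) $L \to S$ are isomorphism classes of spans of cospans $L \leftarrow S' \to S$ with both legs monic. Composition is vertical composition: for $L \leftarrow S' \to S$ and $S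 \leftarrow S'' \to L'$, the composite is $L \leftarrow S' \times_S S'' \to L'$, with legs the projections followed by $S' \to L$ and $S'' \to L'$, and with the induced maps from $X$ and $Y$ to $S'\times_S S''$. Identities are the spans of cospans whose legs are identities. - Composition functor: for $0$-cells $X,Y,Z$, the pair of $1$-cells $X \to S \leftarrow Y$, $Y \to T \leftarrow Z$ is sent to $X \to S +_Y T \leftarrow Z$; the pair of $2$-cells $L \leftarrow S' \to S$ (between cospans from $X$ to $Y$) and $R \leftarrow T' \to T$ (between cospans from $Y$ to $Z$) is sent to the horizontal composite $L +_Y R \leftarrow S' +_Y T' \to S +_Y T$ with the induced legs and with the maps $X \to S' \to S'+_Y T'$ and $Z \to T' \to S'+_Y T'$. - Identity $1$-cell on $X$: the cospan $X \to X \leftarrow X$ of identity maps. - Associator: for cospans $R$ from $W$ to $X$, $S$ from $X$ to $Y$, $T$ from $Y$ to $Z$, the $2$-cell $(R +_X S) +_Y T \to R +_X (S +_Y T)$ given by the span with apex the iterated pushout $R +_X S +_Y T$ and legs the canonical isomorphisms. - Unitors: for a cospan $S$ from $X$ to $Y$, the $2$-cell $S +_Y Y \to S$ given by the span with apex $S$ and legs the canonical isomorphism and the identity; for a cospan $T$ from $Y$ to $Z$, the $2$-cell between $T$ and $Y +_Y T$ given by the span with apex $T$ and legs the identity and the canonical isomorphism. (These $2$-cells are invertible, inverses being obtained by swapping legs.) *)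

(* Defs.v *)
Set Implicit Arguments.
Unset Strict Implicit.
Unset Printing Implicit Defensive.

(** Composition is written in diagrammatic order: [f ;; g] is "[f], then [g]". *)
Record category := Category {
  ob :> Type;
  hom : ob -> ob -> Type;
  idm : forall X : ob, hom X X;
  comp : forall X Y Z : ob, hom X Y -> hom Y Z -> hom X Z;
  comp_idl : forall (X Y : ob) (f : hom X Y), comp (idm X) f = f;
  comp_idr : forall (X Y : ob) (f : hom X Y), comp f (idm Y) = f;
  comp_assoc : forall (X Y Z W : ob) (f : hom X Y) (g : hom Y Z) (h : hom Z W),
    comp f (comp g h) = comp (comp f g) h
}.
Arguments hom {_} _ _.
Arguments idm {_} _.
Arguments comp {_ _ _ _} _ _.
Notation "f ;; g" := (comp f g) (at level 40, left associativity).

Section Universal.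
Variable C : category.
Implicit Types A B E P Q T U V W X Y Z : C.

Definition monic X Y (m : hom X Y) : Prop :=
  forall Z (g h : hom Z X), g ;; m = h ;; m -> g = h.

Definition is_terminal T : Prop := forall X, exists! f : hom X T, True.

Definition is_product A B P (p1 : hom P A) (p2 : hom P B) : Prop :=
  forall Z (f : hom Z A) (g : hom Z B),
  exists! u : hom Z P, u ;; p1 = f /\ u ;; p2 = g.

Definition is_pullback X Y Z (f : hom X Z) (g : hom Y Z)
    P (p1 : hom P X) (p2 : hom P Y) : Prop :=
  p1 ;; f = p2 ;; g /\
  forall W (h : hom W X) (k : hom W Y), h ;; f = k ;; g ->
  exists! u : hom W P, u ;; p1 = h /\ u ;; p2 = k.

(** [E] with evaluation [ev : E * A -> B], where [(P, p1, p2)] is a product of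
    [E] and [A]: every [f : Z * A -> B] is [(g * A) ;; ev] for a unique
    [g : Z -> E].  Below, [u] is the map [g * A]. *)
Definition is_exponential A B E P (p1 : hom P E) (p2 : hom P A) (ev : hom P B) : Prop :=
  is_product p1 p2 /\
  forall Z Q (q1 : hom Q Z) (q2 : hom Q A), is_product q1 q2 ->
  forall f : hom Q B,
  exists! g : hom Z E, exists u : hom Q P,
    u ;; p1 = q1 ;; g /\ u ;; p2 = q2 /\ u ;; ev = f.

Definition is_subobject_classifier T Om (true : hom T Om) : Prop :=
  is_terminal T /\
  forall U X (m : hom U X), monic m ->
  exists! chi : hom X Om, exists t : hom U T, is_pullback chi true m t.

End Universal.

(** Finite limits are required as a terminal object, binary products and pullbacks. *)
Record is_topos (C : category) : Prop := IsTopos {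
  topos_terminal : exists T : C, is_terminal T;
  topos_products : forall A B : C,
    exists (P : C) (p1 : hom P A) (p2 : hom P B), is_product p1 p2;
  topos_pullbacks : forall (X Y Z : C) (f : hom X Z) (g : hom Y Z),
    exists (P : C) (p1 : hom P X) (p2 : hom P Y), is_pullback f g p1 p2;
  topos_exponentials : forall A B : C,
    exists (E P : C) (p1 : hom P E) (p2 : hom P A) (ev : hom P B),
      is_exponential p1 p2 ev;
  topos_classifier : exists (T Om : C) (true : hom T Om),
    is_subobject_classifier true
}.

(** The mediating map [po_med] is determined by the other components; having it
    as a field only turns unique existence into a function. *)
Record chosen_pushouts (C : category) := ChosenPushouts {
  po_ob : forall U V W : C, hom V U -> hom V W -> C;
  po_l : forall (U V W : C) (f : hom V U) (g : hom V W), hom U (po_ob f g);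
  po_r : forall (U V W : C) (f : hom V U) (g : hom V W), hom W (po_ob f g);
  po_sq : forall (U V W : C) (f : hom V U) (g : hom V W),
    f ;; po_l f g = g ;; po_r f g;
  po_med : forall (U V W : C) (f : hom V U) (g : hom V W)
    (Z : C) (h : hom U Z) (k : hom W Z), f ;; h = g ;; k -> hom (po_ob f g) Z;
  po_med_l : forall (U V W : C) (f : hom V U) (g : hom V W)
    (Z : C) (h : hom U Z) (k : hom W Z) (e : f ;; h = g ;; k),
    po_l f g ;; po_med e = h;
  po_med_r : forall (U V W : C) (f : hom V U) (g : hom V W)
    (Z : C) (h : hom U Z) (k : hom W Z) (e : f ;; h = g ;; k),
    po_r f g ;; po_med e = k;
  po_med_uniq : forall (U V W : C) (f : hom V U) (g : hom V W)
    (Z : C) (h : hom U Z) (k : hom W Z) (e : f ;; h = g ;; k) (u : hom (po_ob f g) Z),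
    po_l f g ;; u = h -> po_r f g ;; u = k -> u = po_med e
}.

(** One-cells and two-cells are also composed in diagrammatic order. *)
Record bicat_data := BicatData {
  cell0 :> Type;
  cell1 : cell0 -> cell0 -> Type;
  cell2 : forall X Y : cell0, cell1 X Y -> cell1 X Y -> Type;
  id2 : forall (X Y : cell0) (f : cell1 X Y), cell2 f f;
  vcomp : forall (X Y : cell0) (f g h : cell1 X Y),
    cell2 f g -> cell2 g h -> cell2 f h;
  id1 : forall X : cell0, cell1 X X;
  comp1 : forall X Y Z : cell0, cell1 X Y -> cell1 Y Z -> cell1 X Z;
  hcomp : forall (X Y Z : cell0) (f f' : cell1 X Y) (g g' : cell1 Y Z),
    cell2 f f' -> cell2 g g' -> cell2 (comp1 f g) (comp1 f' g');
  associator : forall (W X Y Z : cell0)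
    (f : cell1 W X) (g : cell1 X Y) (h : cell1 Y Z),
    cell2 (comp1 (comp1 f g) h) (comp1 f (comp1 g h));
  lunitor : forall (X Y : cell0) (f : cell1 X Y), cell2 (comp1 (id1 X) f) f;
  runitor : forall (X Y : cell0) (f : cell1 X Y), cell2 (comp1 f (id1 Y)) f
}.
Arguments cell1 {_} _ _.
Arguments cell2 {_ _ _} _ _.
Arguments id2 {_ _ _} _.
Arguments vcomp {_ _ _ _ _ _} _ _.
Arguments id1 {_} _.
Arguments comp1 {_ _ _ _} _ _.
Arguments hcomp {_ _ _ _ _ _ _ _} _ _.
Arguments associator {_ _ _ _ _} _ _ _.
Arguments lunitor {_ _ _} _.
Arguments runitor {_ _ _} _.

Definition invertible2 (B : bicat_data) (X Y : B) (f g : cell1 X Y) (a : cell2 f g) : Prop :=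
  exists b : cell2 g f, vcomp a b = id2 f /\ vcomp b a = id2 g.

Record is_bicategory (B : bicat_data) : Prop := IsBicategory {
  vcomp_idl : forall (X Y : B) (f g : cell1 X Y) (a : cell2 f g),
    vcomp (id2 f) a = a;
  vcomp_idr : forall (X Y : B) (f g : cell1 X Y) (a : cell2 f g),
    vcomp a (id2 g) = a;
  vcomp_assoc : forall (X Y : B) (f g h k : cell1 X Y)
    (a : cell2 f g) (b : cell2 g h) (c : cell2 h k),
    vcomp a (vcomp b c) = vcomp (vcomp a b) c;
  hcomp_id : forall (X Y Z : B) (f : cell1 X Y) (g : cell1 Y Z),
    hcomp (id2 f) (id2 g) = id2 (comp1 f g);
  hcomp_vcomp : forall (X Y Z : B) (f f' f'' : cell1 X Y) (g g' g'' : cell1 Y Z)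
    (a : cell2 f f') (a' : cell2 f' f'') (b : cell2 g g') (b' : cell2 g' g''),
    hcomp (vcomp a a') (vcomp b b') = vcomp (hcomp a b) (hcomp a' b');
  associator_natural : forall (W X Y Z : B)
    (f f' : cell1 W X) (g g' : cell1 X Y) (h h' : cell1 Y Z)
    (a : cell2 f f') (b : cell2 g g') (c : cell2 h h'),
    vcomp (hcomp (hcomp a b) c) (associator f' g' h')
    = vcomp (associator f g h) (hcomp a (hcomp b c));
  associator_invertible : forall (W X Y Z : B)
    (f : cell1 W X) (g : cell1 X Y) (h : cell1 Y Z),
    invertible2 (associator f g h);
  lunitor_natural : forall (X Y : B) (f g : cell1 X Y) (a : cell2 f g),
    vcomp (hcomp (id2 (id1 X)) a) (lunitor g) = vcomp (lunitor f) a;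
  lunitor_invertible : forall (X Y : B) (f : cell1 X Y), invertible2 (lunitor f);
  runitor_natural : forall (X Y : B) (f g : cell1 X Y) (a : cell2 f g),
    vcomp (hcomp a (id2 (id1 Y))) (runitor g) = vcomp (runitor f) a;
  runitor_invertible : forall (X Y : B) (f : cell1 X Y), invertible2 (runitor f);
  pentagon : forall (V W X Y Z : B)
    (f : cell1 V W) (g : cell1 W X) (h : cell1 X Y) (k : cell1 Y Z),
    vcomp (associator (comp1 f g) h k) (associator f g (comp1 h k))
    = vcomp (vcomp (hcomp (associator f g h) (id2 k)) (associator f (comp1 g h) k))
            (hcomp (id2 f) (associator g h k));
  triangle : forall (X Y Z : B) (f : cell1 X Y) (g : cell1 Y Z),
    vcomp (associator f (id1 Y) g) (hcomp (id2 f) (lunitor g))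
    = hcomp (runitor f) (id2 g)
}.

Section SpansOfCospans.
Variable C : category.

Record cospan (X Y : C) := Cospan {
  apex :> C;
  ft_l : hom X apex;
  ft_r : hom Y apex
}.
Arguments ft_l {_ _} _.
Arguments ft_r {_ _} _.

Record cospan_map (X Y : C) (S T : cospan X Y) := CospanMap {
  cmap :> hom S T;
  cmap_l : ft_l S ;; cmap = ft_l T;
  cmap_r : ft_r S ;; cmap = ft_r T
}.

Record span_of_cospans (X Y : C) (L S : cospan X Y) := SpanOfCospans {
  mid :> cospan X Y;
  leg_l : cospan_map mid L;
  leg_r : cospan_map mid S
}.
Arguments leg_l {_ _ _ _} _.
Arguments leg_r {_ _ _ _} _.

Definition monic_legs (X Y : C) (L S : cospan X Y) (s : span_of_cospans L S) : Prop :=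
  monic (leg_l s) /\ monic (leg_r s).

Definition is_span_map (X Y : C) (L S : cospan X Y) (s t : span_of_cospans L S)
    (f : cospan_map s t) : Prop :=
  f ;; leg_l t = leg_l s /\ f ;; leg_r t = leg_r s.

Definition span_iso (X Y : C) (L S : cospan X Y) (s t : span_of_cospans L S) : Prop :=
  exists f : cospan_map s t, is_span_map f /\
  exists g : hom t s, f ;; g = idm s /\ g ;; f = idm t.

(** An isomorphism class is represented by the predicate "belongs to the class". *)
Record mcell (X Y : C) (L S : cospan X Y) := MCell {
  in_mcell :> span_of_cospans L S -> Prop;
  mcellP : exists s, monic_legs s /\ in_mcell = span_iso s
}.

Definition id_cmap (X Y : C) (S : cospan X Y) : cospan_map S S :=
  CospanMap (comp_idr (ft_l S)) (comp_idr (ft_r S)).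

Definition id_span (X Y : C) (S : cospan X Y) : span_of_cospans S S :=
  SpanOfCospans (id_cmap S) (id_cmap S).

Definition is_vcomposite (X Y : C) (L S L' : cospan X Y)
    (s : span_of_cospans L S) (t : span_of_cospans S L')
    (u : span_of_cospans L L') : Prop :=
  exists (p1 : cospan_map u s) (p2 : cospan_map u t),
    is_pullback (leg_r s) (leg_l t) p1 p2 /\
    leg_l u = p1 ;; leg_l s :> hom u L /\
    leg_r u = p2 ;; leg_r t :> hom u L'.

Definition id_cospan (X : C) : cospan X X := Cospan (idm X) (idm X).

Variable po : chosen_pushouts C.

Definition cospan_comp (X Y Z : C) (S : cospan X Y) (T : cospan Y Z) : cospan X Z :=
  Cospan (ft_l S ;; po_l po (ft_r S) (ft_l T)) (ft_r T ;; po_r po (ft_r S) (ft_l T)).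

Section PushoutMap.
Variables (X Y Z : C) (S' S : cospan X Y) (T' T : cospan Y Z).
Variables (f : cospan_map S' S) (g : cospan_map T' T).

Lemma po_map_sq :
  ft_r S' ;; (f ;; po_l po (ft_r S) (ft_l T)) = ft_l T' ;; (g ;; po_r po (ft_r S) (ft_l T)).
Proof. now rewrite !comp_assoc, cmap_r, cmap_l, po_sq. Qed.

Lemma po_map_l :
  ft_l (cospan_comp S' T') ;; po_med po po_map_sq = ft_l (cospan_comp S T).
Proof. simpl; now rewrite <- comp_assoc, po_med_l, comp_assoc, cmap_l. Qed.

Lemma po_map_r :
  ft_r (cospan_comp S' T') ;; po_med po po_map_sq = ft_r (cospan_comp S T).
Proof. simpl; now rewrite <- comp_assoc, po_med_r, comp_assoc, cmap_r. Qed.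

Definition po_map : cospan_map (cospan_comp S' T') (cospan_comp S T) :=
  CospanMap (S := cospan_comp S' T') (T := cospan_comp S T) po_map_l po_map_r.
End PushoutMap.

Definition span_hcomp (X Y Z : C) (L S : cospan X Y) (R T : cospan Y Z)
    (s : span_of_cospans L S) (t : span_of_cospans R T) :
    span_of_cospans (cospan_comp L R) (cospan_comp S T) :=
  SpanOfCospans (po_map (leg_l s) (leg_l t)) (po_map (leg_r s) (leg_r t)).

(** [P] is the iterated pushout [R +_X S +_Y T], that is, the colimit of the
    zigzag [R <- X -> S <- Y -> T], with coprojections [iR], [iS], [iT]. *)
Definition is_iterated_pushout (W X Y Z : C)
    (R : cospan W X) (S : cospan X Y) (T : cospan Y Z)
    (P : C) (iR : hom R P) (iS : hom S P) (iT : hom T P) : Prop :=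
  ft_r R ;; iR = ft_l S ;; iS /\ ft_r S ;; iS = ft_l T ;; iT /\
  forall (Q : C) (jR : hom R Q) (jS : hom S Q) (jT : hom T Q),
    ft_r R ;; jR = ft_l S ;; jS -> ft_r S ;; jS = ft_l T ;; jT ->
    exists! u : hom P Q, iR ;; u = jR /\ iS ;; u = jS /\ iT ;; u = jT.

(** The legs are the canonical isomorphisms: the maps commuting with the
    coprojections of [R], [S] and [T]. *)
Definition is_associator_span (W X Y Z : C)
    (R : cospan W X) (S : cospan X Y) (T : cospan Y Z)
    (u : span_of_cospans (cospan_comp (cospan_comp R S) T)
                         (cospan_comp R (cospan_comp S T))) : Prop :=
  let RS := cospan_comp R S in
  let ST := cospan_comp S T in
  exists (iR : hom R u) (iS : hom S u) (iT : hom T u),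
    is_iterated_pushout iR iS iT /\
    ft_l u = ft_l R ;; iR /\ ft_r u = ft_r T ;; iT /\
    iR ;; leg_l u = po_l po (ft_r R) (ft_l S) ;; po_l po (ft_r RS) (ft_l T) /\
    iS ;; leg_l u = po_r po (ft_r R) (ft_l S) ;; po_l po (ft_r RS) (ft_l T) /\
    iT ;; leg_l u = po_r po (ft_r RS) (ft_l T) /\
    iR ;; leg_r u = po_l po (ft_r R) (ft_l ST) /\
    iS ;; leg_r u = po_l po (ft_r S) (ft_l T) ;; po_r po (ft_r R) (ft_l ST) /\
    iT ;; leg_r u = po_r po (ft_r S) (ft_l T) ;; po_r po (ft_r R) (ft_l ST).

Section Unitors.
Variables X Y : C.
Variable S : cospan X Y.

Lemma runitor_map_r :
  ft_r S ;; po_l po (ft_r S) (ft_l (id_cospan Y)) = ft_r (cospan_comp S (id_cospan Y)).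
Proof. apply po_sq. Qed.

Lemma lunitor_map_l :
  ft_l S ;; po_r po (ft_r (id_cospan X)) (ft_l S) = ft_l (cospan_comp (id_cospan X) S).
Proof. symmetry; apply po_sq. Qed.

(** The canonical isomorphism between [S] and [S +_Y Y] (resp. [X +_X S]) is the
    coprojection of [S]. *)
Definition runitor_span : span_of_cospans (cospan_comp S (id_cospan Y)) S :=
  SpanOfCospans
    (CospanMap (T := cospan_comp S (id_cospan Y)) (eq_refl _) runitor_map_r)
    (id_cmap S).

Definition lunitor_span : span_of_cospans (cospan_comp (id_cospan X) S) S :=
  SpanOfCospans
    (CospanMap (T := cospan_comp (id_cospan X) S) lunitor_map_l (eq_refl _))
    (id_cmap S).
End Unitors.

(** The operations of MonSp(Csp(C)) on 2-cells.  Each is specified by the span(s)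
    its value contains; as a 2-cell is a full isomorphism class, this determines
    it.  In particular [mhcompP] forces horizontal composites of spans with monic
    legs to have monic legs. *)
Record MonSpCsp_operations := MonSpCspOperations {
  mid2 : forall (X Y : C) (S : cospan X Y), mcell S S;
  mvcomp : forall (X Y : C) (L S L' : cospan X Y),
    mcell L S -> mcell S L' -> mcell L L';
  mhcomp : forall (X Y Z : C) (L S : cospan X Y) (R T : cospan Y Z),
    mcell L S -> mcell R T -> mcell (cospan_comp L R) (cospan_comp S T);
  massociator : forall (W X Y Z : C) (R : cospan W X) (S : cospan X Y) (T : cospan Y Z),
    mcell (cospan_comp (cospan_comp R S) T) (cospan_comp R (cospan_comp S T));
  mlunitor : forall (X Y : C) (S : cospan X Y), mcell (cospan_comp (id_cospan X) S) S;
  mrunitor : forall (X Y : C) (S : cospan X Y), mcell (cospan_comp S (id_cospan Y)) S;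

  mid2P : forall (X Y : C) (S : cospan X Y), mid2 S (id_span S);
  mvcompP : forall (X Y : C) (L S L' : cospan X Y) (a : mcell L S) (b : mcell S L') s t u,
    a s -> b t -> is_vcomposite s t u -> mvcomp a b u;
  mhcompP : forall (X Y Z : C) (L S : cospan X Y) (R T : cospan Y Z)
    (a : mcell L S) (b : mcell R T) s t,
    a s -> b t -> mhcomp a b (span_hcomp s t);
  massociatorP : forall (W X Y Z : C) (R : cospan W X) (S : cospan X Y) (T : cospan Y Z) u,
    is_associator_span u -> massociator R S T u;
  mlunitorP : forall (X Y : C) (S : cospan X Y), mlunitor S (lunitor_span S);
  mrunitorP : forall (X Y : C) (S : cospan X Y), mrunitor S (runitor_span S)
}.

Definition MonSpCsp (D : MonSpCsp_operations) : bicat_data := {|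
  cell0 := C;
  cell1 := cospan;
  cell2 := mcell;
  id2 := mid2 D;
  vcomp := mvcomp D;
  id1 := id_cospan;
  comp1 := cospan_comp;
  hcomp := mhcomp D;
  associator := massociator D;
  lunitor := mlunitor D;
  runitor := mrunitor D
|}.

End SpansOfCospans.

(* Main.v *)
(** The coherence laws are formal: associators and unitors are graphs of invertible
    maps of cospans, and vertical composition with a graph only changes one leg.
    What needs the topos is that [(- +_Y -)] preserves monos and intersections.

    A relation on [X] and [W] is a map [X -> Om^W], so relations glue along pushouts:
    compatible relations on [S, W] and [T, W] come from a unique one on [S +_Y T, W].
    Hence [S] and [T] cover [S +_Y T] stably under pullback, and partial maps glue.
    For subobjects [S' <= S] and [T' <= T] under [Y], the partial maps [S -> S' +_Y T']
    and [T -> S' +_Y T'] glue to a partial inverse of [S' +_Y T' -> S +_Y T], which is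
    thus monic and meets [S] in [S'] and [T] in [T']; gluing partial maps into
    [(S1 /\ S2) +_Y (T1 /\ T2)] gives the interchange law. *)

From Stdlib Require Import FunctionalExtensionality PropExtensionality
  ProofIrrelevance IndefiniteDescription.
Require Import Defs.

Set Implicit Arguments.
Unset Strict Implicit.
Unset Printing Implicit Defensive.

(** * Relations, partial maps and power objects in a topos *)

Section Relations.
Variable C : category.

Definition jointly_monic (X W R : C) (r1 : hom R X) (r2 : hom R W) : Prop :=
  forall V (u v : hom V R), u ;; r1 = v ;; r1 -> u ;; r2 = v ;; r2 -> u = v.

(** The generalized elements [(x, w)] of the relation tabulated by [(r1, r2)]. *)
Definition rel (X W R : C) (r1 : hom R X) (r2 : hom R W)
    (V : C) (x : hom V X) (w : hom V W) : Prop :=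
  exists u : hom V R, u ;; r1 = x /\ u ;; r2 = w.

Lemma jointly_monic_l (X W R : C) (r1 : hom R X) (r2 : hom R W) :
  monic r1 -> jointly_monic r1 r2.
Proof. intros Hm V u v e _. exact (Hm _ _ _ e). Qed.

(** A span [(d, h)] with [d] monic is a partial map from [X] to [Z] with domain [D]. Partial maps
    are encoded as such relations, so that they can be glued like relations; single-valuedness is
    what [d] monic gives. *)
Lemma rel_functional (X Z D : C) (d : hom D X) (h : hom D Z) (V : C)
    (x : hom V X) (z z' : hom V Z) :
  monic d -> rel d h x z -> rel d h x z' -> z = z'.
Proof.
  intros Hd (u & e & <-) (u' & e' & <-). f_equal. apply Hd. now rewrite e, e'.
Qed.

Lemma monic_comp (X Y Z : C) (f : hom X Y) (g : hom Y Z) :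
  monic f -> monic g -> monic (f ;; g).
Proof.
  intros Hf Hg V u v e. apply Hf, Hg. now rewrite <- !comp_assoc.
Qed.

Lemma monic_cancel (X Y Z : C) (f : hom X Y) (g : hom Y Z) :
  monic (f ;; g) -> monic f.
Proof.
  intros Hfg V u v e. apply Hfg. now rewrite !comp_assoc, e.
Qed.

Lemma monic_split (X Y : C) (f : hom X Y) (g : hom Y X) : f ;; g = idm X -> monic f.
Proof.
  intros e. apply (@monic_cancel _ _ _ f g). rewrite e.
  intros V u v. now rewrite !comp_idr.
Qed.

Lemma pullback_jointly_monic (X Y Z P : C) (f : hom X Z) (g : hom Y Z)
    (p1 : hom P X) (p2 : hom P Y) :
  is_pullback f g p1 p2 -> jointly_monic p1 p2.
Proof.
  intros [e H] V u v e1 e2.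
  destruct (H V (u ;; p1) (u ;; p2)) as (w & _ & Hw).
  { now rewrite <- !comp_assoc, e. }
  rewrite <- (Hw u), <- (Hw v); auto.
Qed.

Lemma pullback_monic_l (X Y Z P : C) (f : hom X Z) (g : hom Y Z)
    (p1 : hom P X) (p2 : hom P Y) :
  is_pullback f g p1 p2 -> monic g -> monic p1.
Proof.
  intros H Hg V u v e. apply (pullback_jointly_monic H); trivial.
  apply Hg. destruct H as [e' _]. now rewrite <- !comp_assoc, <- e', !comp_assoc, e.
Qed.

Lemma pullback_monic_r (X Y Z P : C) (f : hom X Z) (g : hom Y Z)
    (p1 : hom P X) (p2 : hom P Y) :
  is_pullback f g p1 p2 -> monic f -> monic p2.
Proof.
  intros H Hf V u v e. apply (pullback_jointly_monic H); trivial.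
  apply Hf. destruct H as [e' _]. now rewrite <- !comp_assoc, e', !comp_assoc, e.
Qed.

Lemma product_ext (A B P : C) (p1 : hom P A) (p2 : hom P B) :
  is_product p1 p2 -> jointly_monic p1 p2.
Proof.
  intros H V u v e1 e2. destruct (H V (u ;; p1) (u ;; p2)) as (w & _ & Hw).
  rewrite <- (Hw u), <- (Hw v); auto.
Qed.

Hypothesis HC : is_topos C.

(** When [(m1, m2)] is the membership relation of a power object [E], this recovers a relation from
    the map [g] that names it. *)
Lemma rel_pullback (X E W M : C) (m1 : hom M E) (m2 : hom M W) (g : hom X E) :
  jointly_monic m1 m2 ->
  exists (R : C) (r1 : hom R X) (r2 : hom R W), jointly_monic r1 r2 /\
    forall V (x : hom V X) (w : hom V W), rel r1 r2 x w <-> rel m1 m2 (x ;; g) w.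
Proof.
  intros Hm. destruct (topos_pullbacks HC g m1) as (R & r1 & r2 & Hpb).
  exists R, r1, (r2 ;; m2). split.
  - intros V u v e1 e2. apply (pullback_jointly_monic Hpb); trivial.
    apply Hm; [|now rewrite <- !comp_assoc].
    destruct Hpb as [e _]. now rewrite <- !comp_assoc, <- e, !comp_assoc, e1.
  - intros V x w. split.
    + intros (u & <- & <-). exists (u ;; r2). destruct Hpb as [e _].
      now rewrite <- !comp_assoc, <- e.
    + intros (u & e1 & <-). destruct Hpb as [_ H].
      destruct (H V x u (eq_sym e1)) as (k & [<- <-] & _).
      exists k. now rewrite comp_assoc.
Qed.

(** The equalizer is the pullback of the diagonal [d] of [Y] along the pairing [fg]. *)
Lemma equalizer_exists (X Y : C) (f g : hom X Y) :
  exists (E : C) (e : hom E X), monic e /\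
    forall V (v : hom V X), v ;; f = v ;; g <-> exists u, u ;; e = v.
Proof.
  destruct (topos_products HC Y Y) as (P & p1 & p2 & HP).
  destruct (HP X f g) as (fg & [Hf Hg] & _).
  destruct (HP Y (idm Y) (idm Y)) as (d & [Hd1 Hd2] & _).
  destruct (topos_pullbacks HC fg d) as (E & e & e' & Hpb).
  exists E, e. split.
  - exact (pullback_monic_l Hpb (monic_split Hd1)).
  - destruct Hpb as [sq H]. intros V v. split.
    + intros Hv. destruct (H V v (v ;; f)) as (u & [Hu _] & _).
      * apply (product_ext HP).
        -- now rewrite <- !comp_assoc, Hf, Hd1, comp_idr.
        -- now rewrite <- !comp_assoc, Hg, Hd2, comp_idr.
      * now exists u.
    + intros [u <-].
      rewrite <- Hf, <- Hg.
      now rewrite <- !comp_assoc, !(comp_assoc e), sq, <- !comp_assoc, Hd1, Hd2.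
Qed.

(** The exponential [Om^W], with its membership relation. *)
Lemma power_object (W : C) :
  exists (E M : C) (m1 : hom M E) (m2 : hom M W), jointly_monic m1 m2 /\
    (forall X R (r1 : hom R X) (r2 : hom R W), jointly_monic r1 r2 ->
      exists g : hom X E, forall V (x : hom V X) (w : hom V W),
        rel m1 m2 (x ;; g) w <-> rel r1 r2 x w) /\
    (forall X (g g' : hom X E),
      (forall V (x : hom V X) (w : hom V W),
        rel m1 m2 (x ;; g) w <-> rel m1 m2 (x ;; g') w) -> g = g').
Proof.
  destruct (topos_classifier HC) as (T & Om & true & HT & Hcl).
  destruct (topos_exponentials HC W Om) as (E & P & p1 & p2 & ev & HP & Hexp).
  (* Membership is the subobject of [E * W] classified by the evaluation map. *)
  destruct (topos_pullbacks HC ev true) as (M & m & mt & Hm).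
  assert (Hterm : forall V (t t' : hom V T), t = t').
  { intros V t t'. destruct (HT V) as (c & _ & Hc). now rewrite <- (Hc t), <- (Hc t'). }
  assert (Htrue : monic true) by (intros V u v _; apply Hterm).
  assert (Hmm : monic m) by exact (pullback_monic_l Hm Htrue).
  assert (Hmem : forall V (u : hom V P),
    rel (m ;; p1) (m ;; p2) (u ;; p1) (u ;; p2) <-> exists t, u ;; ev = t ;; true).
  { intros V u. destruct Hm as [sq H]. split.
    - intros (k & e1 & e2). exists (k ;; mt).
      assert (k ;; m = u) as <-.
      { apply (product_ext HP); now rewrite <- comp_assoc. }
      now rewrite <- !comp_assoc, sq.
    - intros [t e]. destruct (H V u t e) as (k & [<- _] & _).
      exists k. now rewrite !comp_assoc. }
  exists E, M, (m ;; p1), (m ;; p2). split; [|split].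
  - intros V u v e1 e2. apply Hmm, (product_ext HP); now rewrite <- !comp_assoc.
  - intros X R r1 r2 Hr.
    destruct (topos_products HC X W) as (Q & q1 & q2 & HQ).
    destruct (HQ R r1 r2) as (r & [Hr1 Hr2] & _).
    assert (Hrm : monic r).
    { intros V u v e. apply Hr.
      - now rewrite <- Hr1, !comp_assoc, e.
      - now rewrite <- Hr2, !comp_assoc, e. }
    (* The name of the relation is the transpose of the characteristic map of [R] in [X * W]. *)
    destruct (Hcl R Q r Hrm) as (chi & (t & sq & Hpb) & _).
    destruct (Hexp X Q q1 q2 HQ chi) as (g & (u & Hu1 & Hu2 & Hev) & _).
    exists g. intros V x w.
    destruct (HQ V x w) as (xw & [<- <-] & _).
    rewrite <- comp_assoc, <- Hu1, <- Hu2, !comp_assoc, Hmem, <- !comp_assoc, Hu2, Hev.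
    split.
    + intros [t' e]. destruct (Hpb V xw t' e) as (k & [Hk _] & _).
      exists k. now rewrite <- Hr1, <- Hr2, !comp_assoc, Hk.
    + intros (k & e1 & e2). exists (k ;; t).
      assert (k ;; r = xw) as <-.
      { apply (product_ext HQ); now rewrite <- comp_assoc, ?Hr1, ?Hr2. }
      now rewrite <- !comp_assoc, sq.
  - intros X g g' Hgg.
    destruct (topos_products HC X W) as (Q & q1 & q2 & HQ).
    destruct (HP Q (q1 ;; g) q2) as (u & [Hu1 Hu2] & _).
    destruct (HP Q (q1 ;; g') q2) as (u' & [Hu1' Hu2'] & _).
    assert (Hiff : forall V (v : hom V Q),
      (exists t, v ;; (u ;; ev) = t ;; true) <-> exists t, v ;; (u' ;; ev) = t ;; true).
    { intros V v. rewrite !comp_assoc, <- !Hmem, <- !comp_assoc, Hu1, Hu2, Hu1', Hu2'.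
      rewrite !comp_assoc. apply Hgg. }
    (* Both maps send the same elements to [true], so both classify the subobject [r]; a subobject
       has only one characteristic map. *)
    assert (Hchi : u ;; ev = u' ;; ev).
    { destruct (topos_pullbacks HC (u ;; ev) true) as (R & r & t & Hpb).
      destruct (Hcl R Q r (pullback_monic_l Hpb Htrue)) as (chi & _ & Huniq).
      transitivity chi; [symmetry|]; apply Huniq; exists t; [exact Hpb|].
      destruct Hpb as [sq Hpb]. split.
      - destruct (proj1 (Hiff R r)) as [t' Ht']; [now exists t|].
        now rewrite Ht', (Hterm _ t t').
      - intros V h k e. apply Hpb.
        destruct (proj2 (Hiff V h)) as [t' Ht']; [now exists k|].
        now rewrite Ht', (Hterm _ k t'). }
    destruct (Hexp X Q q1 q2 HQ (u ;; ev)) as (g0 & _ & Huniq).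
    transitivity g0; [symmetry|]; apply Huniq; [exists u|exists u']; auto.
Qed.

Variable po : chosen_pushouts C.

Lemma po_ext (U V W Z : C) (f : hom V U) (g : hom V W) (u v : hom (po_ob po f g) Z) :
  po_l po f g ;; u = po_l po f g ;; v -> po_r po f g ;; u = po_r po f g ;; v -> u = v.
Proof.
  intros e1 e2.
  assert (e : f ;; (po_l po f g ;; v) = g ;; (po_r po f g ;; v)).
  { now rewrite !comp_assoc, po_sq. }
  transitivity (po_med po e); [|symmetry]; now apply po_med_uniq.
Qed.

(** * Gluing along a pushout *)

Section Glueing.
Variables (S T Y : C) (a : hom Y S) (b : hom Y T).
Local Notation P := (po_ob po a b).
Local Notation i := (po_l po a b).
Local Notation j := (po_r po a b).

(** Compatibility over [Y] says that the names of the two relations agree on [Y]. The mediating map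
    out of the pushout names the glued relation. *)
Lemma glue_relations (W RS RT : C) (s1 : hom RS S) (s2 : hom RS W)
    (t1 : hom RT T) (t2 : hom RT W) :
  jointly_monic s1 s2 -> jointly_monic t1 t2 ->
  (forall V (y : hom V Y) (w : hom V W), rel s1 s2 (y ;; a) w <-> rel t1 t2 (y ;; b) w) ->
  exists (R : C) (r1 : hom R P) (r2 : hom R W), jointly_monic r1 r2 /\
    (forall V (s : hom V S) w, rel r1 r2 (s ;; i) w <-> rel s1 s2 s w) /\
    (forall V (t : hom V T) w, rel r1 r2 (t ;; j) w <-> rel t1 t2 t w).
Proof.
  intros Hs Ht Hst.
  destruct (power_object W) as (E & M & m1 & m2 & Hm & Hname & Hext).
  destruct (Hname _ _ s1 s2 Hs) as [gS HgS].
  destruct (Hname _ _ t1 t2 Ht) as [gT HgT].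
  assert (e : a ;; gS = b ;; gT).
  { apply Hext. intros V y w. now rewrite !comp_assoc, HgS, HgT. }
  destruct (rel_pullback (po_med po e) Hm) as (R & r1 & r2 & Hr & Hrel).
  exists R, r1, r2. split; [exact Hr|]. split; intros V x w; rewrite Hrel, <- comp_assoc.
  - now rewrite po_med_l.
  - now rewrite po_med_r.
Qed.

(** The names of both relations are maps out of [P], hence determined by their composites with [i]
    and [j]. *)
Lemma relation_ext (W R R' : C) (r1 : hom R P) (r2 : hom R W)
    (r1' : hom R' P) (r2' : hom R' W) :
  jointly_monic r1 r2 -> jointly_monic r1' r2' ->
  (forall V (s : hom V S) w, rel r1 r2 (s ;; i) w <-> rel r1' r2' (s ;; i) w) ->
  (forall V (t : hom V T) w, rel r1 r2 (t ;; j) w <-> rel r1' r2' (t ;; j) w) ->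
  forall V (p : hom V P) w, rel r1 r2 p w <-> rel r1' r2' p w.
Proof.
  intros Hr Hr' HS HT V p w.
  destruct (power_object W) as (E & M & m1 & m2 & Hm & Hname & Hext).
  destruct (Hname _ _ r1 r2 Hr) as [g Hg].
  destruct (Hname _ _ r1' r2' Hr') as [g' Hg'].
  rewrite <- Hg, <- Hg'.
  enough (g = g') as -> by reflexivity.
  apply po_ext; apply Hext; intros V' x w'; rewrite !comp_assoc, Hg, Hg'; auto.
Qed.

(** The coprojections [i] and [j] are jointly covering, stably under pullback along
    any [p]. *)
Lemma pushout_cover (Q D : C) (p : hom Q P) (d : hom D Q) :
  monic d ->
  (forall V (v : hom V Q) (s : hom V S), s ;; i = v ;; p -> exists u, u ;; d = v) ->
  (forall V (v : hom V Q) (t : hom V T), t ;; j = v ;; p -> exists u, u ;; d = v) ->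
  exists u, u ;; d = idm Q.
Proof.
  intros Hd HS HT.
  assert (Hid : monic (idm Q)) by (intros V u v; now rewrite !comp_idr).
  (* Compare two relations between [P] and [Q]: the converse of the graph of [p], and its
     restriction to the subobject [D]. They agree over [S] and [T] by hypothesis, hence everywhere.
     The pair [(p, idm Q)] lies in the former, so it lies in the latter, which gives a section of
     [d]. *)
  assert (H1 : jointly_monic (d ;; p) d) by (intros V u v _; apply Hd).
  assert (H2 : jointly_monic p (idm Q)) by (intros V u v _; apply Hid).
  assert (Hrel : forall V (q : hom V P) (w : hom V Q),
    rel (d ;; p) d q w <-> rel p (idm Q) q w).
  { apply relation_ext; trivial; intros V x w; split.
    - intros (u & e1 & <-). exists (u ;; d).
      now rewrite comp_idr, <- comp_assoc.
    - intros (u & e1 & <-). destruct (HS V u x (eq_sym e1)) as [k <-].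
      exists k. now rewrite comp_idr, comp_assoc.
    - intros (u & e1 & <-). exists (u ;; d).
      now rewrite comp_idr, <- comp_assoc.
    - intros (u & e1 & <-). destruct (HT V u x (eq_sym e1)) as [k <-].
      exists k. now rewrite comp_idr, comp_assoc. }
  destruct (proj2 (Hrel Q p (idm Q))) as (u & _ & Hu); [|now exists u].
  exists (idm Q). now rewrite !comp_idl.
Qed.

(** The glued relation is again single-valued because single-valuedness can be tested on the cover
    by [S] and [T]. *)
Lemma glue_partial_maps (Z DS DT : C) (dS : hom DS S) (h : hom DS Z)
    (dT : hom DT T) (k : hom DT Z) :
  monic dS -> monic dT ->
  (forall V (y : hom V Y) (z : hom V Z), rel dS h (y ;; a) z <-> rel dT k (y ;; b) z) ->
  exists (D : C) (d : hom D P) (r : hom D Z), monic d /\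
    (forall V (s : hom V S) z, rel d r (s ;; i) z <-> rel dS h s z) /\
    (forall V (t : hom V T) z, rel d r (t ;; j) z <-> rel dT k t z).
Proof.
  intros HdS HdT Hagree.
  destruct (glue_relations (jointly_monic_l HdS) (jointly_monic_l HdT) Hagree)
    as (D & d & r & Hjm & HS & HT).
  exists D, d, r. split; [|now split].
  intros V x x' e. apply Hjm; trivial.
  (* The locus where the two values agree contains everything lying over [S] or [T], by
     [rel_functional] there. Hence it is all of [V]. *)
  destruct (equalizer_exists (x ;; r) (x' ;; r)) as (E & eq & Heq & Huniv).
  destruct (@pushout_cover V E (x ;; d) eq Heq) as [u Hu].
  - intros V' v s Hs. apply Huniv. apply (rel_functional HdS (h := h) (x := s)); apply HS.
    + exists (v ;; x). now rewrite Hs, !comp_assoc.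
    + exists (v ;; x'). now rewrite Hs, e, !comp_assoc.
  - intros V' v t Ht. apply Huniv. apply (rel_functional HdT (h := k) (x := t)); apply HT.
    + exists (v ;; x). now rewrite Ht, !comp_assoc.
    + exists (v ;; x'). now rewrite Ht, e, !comp_assoc.
  - rewrite <- (comp_idl (x ;; r)), <- (comp_idl (x' ;; r)). apply Huniv. now exists u.
Qed.


End Glueing.

(** Supplies the compatibility required for gluing: [Y] factors through both domains, and there both
    partial maps take the common value [a' ;; h = b' ;; k]. *)
Lemma rel_agree (Y S T S' T' : C) (a : hom Y S) (b : hom Y T)
    (a' : hom Y S') (b' : hom Y T') (f : hom S' S) (g : hom T' T)
    (Z : C) (h : hom S' Z) (k : hom T' Z) :
  monic f -> monic g -> a' ;; f = a -> b' ;; g = b -> a' ;; h = b' ;; k ->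
  forall V (y : hom V Y) (z : hom V Z), rel f h (y ;; a) z <-> rel g k (y ;; b) z.
Proof.
  intros Hf Hg <- <- e V y z. split; intros (u & e1 & <-).
  - exists (y ;; b'). split; [now rewrite comp_assoc|].
    rewrite <- comp_assoc, <- e, comp_assoc. f_equal. apply Hf. now rewrite e1, comp_assoc.
  - exists (y ;; a'). split; [now rewrite comp_assoc|].
    rewrite <- comp_assoc, e, comp_assoc. f_equal. apply Hg. now rewrite e1, comp_assoc.
Qed.

(** * Pushouts of subobjects under a common object *)

Section PushoutMap.
Variables (Y S T S' T' : C) (a : hom Y S) (b : hom Y T) (a' : hom Y S') (b' : hom Y T')
  (f : hom S' S) (g : hom T' T) (n : hom (po_ob po a' b') (po_ob po a b)).
Hypotheses (Hf : monic f) (Hg : monic g) (ef : a' ;; f = a) (eg : b' ;; g = b)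
  (Hl : po_l po a' b' ;; n = f ;; po_l po a b)
  (Hr : po_r po a' b' ;; n = g ;; po_r po a b).

(** With [N] the pushout of [a'] and [b'], the partial map glued from [S <- S' -> N]
    and [T <- T' -> N] turns out to be a partial inverse of [n]. *)
Lemma pushout_map_partial_inverse :
  exists (D : C) (d : hom D (po_ob po a b)) (r : hom D (po_ob po a' b')), monic d /\
    (forall V (s : hom V S) z, rel d r (s ;; po_l po a b) z <-> rel f (po_l po a' b') s z) /\
    (forall V (t : hom V T) z, rel d r (t ;; po_r po a b) z <-> rel g (po_r po a' b') t z) /\
    (forall V (q : hom V (po_ob po a' b')), rel d r (q ;; n) q).
Proof.
  destruct (glue_partial_maps Hf Hg (rel_agree Hf Hg ef eg (po_sq po a' b')))
    as (D & d & r & Hd & HS & HT).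
  exists D, d, r. split; [exact Hd|]. split; [exact HS|]. split; [exact HT|].
  (* The map [n] lands in the domain [D], and [r] undoes it. The lift [u] is glued from lifts of the
     two coprojections, which match on [Y] because [d] is monic. *)
  assert (HN : exists u : hom (po_ob po a' b') D, u ;; d = n /\ u ;; r = idm _).
  { assert (Hl' : rel d r (po_l po a' b' ;; n) (po_l po a' b')).
    { rewrite Hl. apply HS. exists (idm S'). now rewrite !comp_idl. }
    assert (Hr' : rel d r (po_r po a' b' ;; n) (po_r po a' b')).
    { rewrite Hr. apply HT. exists (idm T'). now rewrite !comp_idl. }
    destruct Hl' as (ul & el & el'), Hr' as (ur & er & er').
    assert (e : a' ;; ul = b' ;; ur).
    { apply Hd. now rewrite <- !comp_assoc, el, er, !comp_assoc, po_sq. }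
    exists (po_med po e). split; apply po_ext;
      now rewrite comp_assoc, ?po_med_l, ?po_med_r, ?comp_idr. }
  destruct HN as (u & eu & eu'). intros V q. exists (q ;; u).
  now rewrite <- !comp_assoc, eu, eu', comp_idr.
Qed.

Lemma pushout_map_monic : monic n.
Proof.
  destruct pushout_map_partial_inverse as (D & d & r & Hd & _ & _ & Hn).
  intros V u v e. apply (rel_functional Hd (h := r) (x := u ;; n)); [|rewrite e]; apply Hn.
Qed.

(** The square of left coprojections over [f] and [n] is a pullback: the partial inverse is defined
    on [q ;; n] with value [q], and over [S] it is defined only on [S']. *)
Lemma pushout_map_cartesian_l (V : C) (s : hom V S) (q : hom V (po_ob po a' b')) :
  s ;; po_l po a b = q ;; n -> rel f (po_l po a' b') s q.
Proof.
  destruct pushout_map_partial_inverse as (D & d & r & Hd & HS & _ & Hn).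
  intros e. apply HS. rewrite e. apply Hn.
Qed.

Lemma pushout_map_cartesian_r (V : C) (t : hom V T) (q : hom V (po_ob po a' b')) :
  t ;; po_r po a b = q ;; n -> rel g (po_r po a' b') t q.
Proof.
  destruct pushout_map_partial_inverse as (D & d & r & Hd & _ & HT & Hn).
  intros e. apply HT. rewrite e. apply Hn.
Qed.

End PushoutMap.

(** Pushouts under [Y] of subobjects commute with intersection: glue the partial
    maps [S <- U -> M] and [T <- V -> M] to a partial map into the pushout [M] of
    [U] and [V], and see with [pushout_cover] that it is defined on the
    intersection of [N1] and [N2]. *)
Lemma pushout_map_pullback (Y S T S1 T1 S2 T2 U V : C) (a : hom Y S) (b : hom Y T)
    (a1 : hom Y S1) (b1 : hom Y T1) (a2 : hom Y S2) (b2 : hom Y T2)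
    (a' : hom Y U) (b' : hom Y V)
    (f1 : hom S1 S) (f2 : hom S2 S) (g1 : hom T1 T) (g2 : hom T2 T)
    (u1 : hom U S1) (u2 : hom U S2) (v1 : hom V T1) (v2 : hom V T2)
    (n1 : hom (po_ob po a1 b1) (po_ob po a b)) (n2 : hom (po_ob po a2 b2) (po_ob po a b))
    (m1 : hom (po_ob po a' b') (po_ob po a1 b1)) (m2 : hom (po_ob po a' b') (po_ob po a2 b2)) :
  monic f1 -> monic f2 -> monic g1 -> monic g2 ->
  a1 ;; f1 = a -> b1 ;; g1 = b -> a2 ;; f2 = a -> b2 ;; g2 = b ->
  a' ;; u1 = a1 -> b' ;; v1 = b1 ->
  is_pullback f1 f2 u1 u2 -> is_pullback g1 g2 v1 v2 ->
  po_l po a1 b1 ;; n1 = f1 ;; po_l po a b -> po_r po a1 b1 ;; n1 = g1 ;; po_r po a b ->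
  po_l po a2 b2 ;; n2 = f2 ;; po_l po a b -> po_r po a2 b2 ;; n2 = g2 ;; po_r po a b ->
  po_l po a' b' ;; m1 = u1 ;; po_l po a1 b1 -> po_r po a' b' ;; m1 = v1 ;; po_r po a1 b1 ->
  po_l po a' b' ;; m2 = u2 ;; po_l po a2 b2 -> po_r po a' b' ;; m2 = v2 ;; po_r po a2 b2 ->
  is_pullback n1 n2 m1 m2.
Proof.
  intros Hf1 Hf2 Hg1 Hg2 ea1 eb1 ea2 eb2 ea' eb' [sqU HU] [sqV HV]
    l1 r1 l2 r2 ml1 mr1 ml2 mr2.
  assert (sqM : m1 ;; n1 = m2 ;; n2).
  { apply po_ext; rewrite !comp_assoc.
    - now rewrite ml1, ml2, <- !comp_assoc, l1, l2, !comp_assoc, sqU.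
    - now rewrite mr1, mr2, <- !comp_assoc, r1, r2, !comp_assoc, sqV. }
  assert (Hn1 : monic n1) by exact (pushout_map_monic Hf1 Hg1 ea1 eb1 l1 r1).
  assert (Hn2 : monic n2) by exact (pushout_map_monic Hf2 Hg2 ea2 eb2 l2 r2).
  (* [f] and [g] are the inclusions of the two intersections, and [m] is the map of pushouts they
     induce, so [m] has a partial inverse [(d, r)]. *)
  set (f := u1 ;; f1). set (g := v1 ;; g1). set (m := m1 ;; n1).
  assert (Hf : monic f).
  { apply monic_comp; trivial. exact (pullback_monic_l (conj sqU HU) Hf2). }
  assert (Hg : monic g).
  { apply monic_comp; trivial. exact (pullback_monic_l (conj sqV HV) Hg2). }
  assert (ef : a' ;; f = a) by (unfold f; now rewrite comp_assoc, ea').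
  assert (eg : b' ;; g = b) by (unfold g; now rewrite comp_assoc, eb').
  assert (ml : po_l po a' b' ;; m = f ;; po_l po a b).
  { unfold f, m. now rewrite comp_assoc, ml1, <- !comp_assoc, l1. }
  assert (mr : po_r po a' b' ;; m = g ;; po_r po a b).
  { unfold g, m. now rewrite comp_assoc, mr1, <- !comp_assoc, r1. }
  assert (Hm1 : monic m1) by exact (monic_cancel (pushout_map_monic Hf Hg ef eg ml mr)).
  destruct (pushout_map_partial_inverse Hf Hg ef eg ml mr)
    as (D & d & r & Hd & HS & HT & _).
  split; [exact sqM|]. intros W x x' e.
  (* The partial inverse is defined on [x ;; n1]. On the cover, a point of [S] lying in both [N1]
     and [N2] lies in [S1] and [S2] by cartesianness, hence in [U]; likewise for [T] and [V]. *)
  assert (Hz : exists w, w ;; d = x ;; n1).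
  { destruct (topos_pullbacks HC (x ;; n1) d) as (E & c & c' & Hpb).
    destruct (@pushout_cover S T Y a b W E (x ;; n1) c (pullback_monic_l Hpb Hd)) as [w Hw].
    - intros V' v s Hs. rewrite comp_assoc in Hs.
      destruct (pushout_map_cartesian_l Hf1 Hg1 ea1 eb1 l1 r1 Hs) as (s1 & Hs1 & _).
      rewrite <- comp_assoc, e, comp_assoc in Hs.
      destruct (pushout_map_cartesian_l Hf2 Hg2 ea2 eb2 l2 r2 Hs) as (s2 & Hs2 & _).
      destruct (HU V' s1 s2) as (u & [Hu _] & _); [now rewrite Hs1|].
      destruct (proj2 (HS V' s (u ;; po_l po a' b'))) as (k & Hk & _).
      { exists u. unfold f. now rewrite comp_assoc, Hu. }
      destruct Hpb as [_ Hpb]. destruct (Hpb V' v k) as (q & [Hq _] & _); [|now exists q].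
      now rewrite Hk, Hs, e, comp_assoc.
    - intros V' v t Ht. rewrite comp_assoc in Ht.
      destruct (pushout_map_cartesian_r Hf1 Hg1 ea1 eb1 l1 r1 Ht) as (t1 & Ht1 & _).
      rewrite <- comp_assoc, e, comp_assoc in Ht.
      destruct (pushout_map_cartesian_r Hf2 Hg2 ea2 eb2 l2 r2 Ht) as (t2 & Ht2 & _).
      destruct (HV V' t1 t2) as (u & [Hu _] & _); [now rewrite Ht1|].
      destruct (proj2 (HT V' t (u ;; po_r po a' b'))) as (k & Hk & _).
      { exists u. unfold g. now rewrite comp_assoc, Hu. }
      destruct Hpb as [_ Hpb]. destruct (Hpb V' v k) as (q & [Hq _] & _); [|now exists q].
      now rewrite Hk, Ht, e, comp_assoc.
    - exists (w ;; c'). destruct Hpb as [sq _].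
      now rewrite <- comp_assoc, <- sq, comp_assoc, Hw, comp_idl. }
  destruct Hz as [w Hw]. set (z := w ;; r).
  (* That [m] undoes the partial inverse is again tested on the cover, through the equalizer of the
     two sides. *)
  assert (Hz : z ;; m = x ;; n1).
  { destruct (equalizer_exists (z ;; m) (x ;; n1)) as (E & c & Hc & Huniv).
    destruct (@pushout_cover S T Y a b W E (x ;; n1) c Hc) as [q Hq].
    - intros V' v s Hs. apply Huniv.
      destruct (proj1 (HS V' s (v ;; z))) as (u & Hu & Hu').
      { exists (v ;; w). unfold z. now rewrite <- !comp_assoc, Hw, Hs. }
      now rewrite comp_assoc, <- Hu', <- comp_assoc, ml, comp_assoc, Hu.
    - intros V' v t Ht. apply Huniv.
      destruct (proj1 (HT V' t (v ;; z))) as (u & Hu & Hu').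
      { exists (v ;; w). unfold z. now rewrite <- !comp_assoc, Hw, Ht. }
      now rewrite comp_assoc, <- Hu', <- comp_assoc, mr, comp_assoc, Hu.
    - rewrite <- (comp_idl (z ;; m)), <- (comp_idl (x ;; n1)). apply Huniv. now exists q. }
  assert (Hz1 : z ;; m1 = x) by (apply Hn1; now rewrite <- comp_assoc).
  exists z. split.
  - split; [exact Hz1|]. apply Hn2. now rewrite <- comp_assoc, <- sqM, comp_assoc, Hz1.
  - intros z' [Hz' _]. apply Hm1. now rewrite Hz1.
Qed.

End Relations.

(** * Isomorphism classes of spans and vertical composition *)

Section SpanCells.
Variable C : category.

Definition cmap_comp (X Y : C) (S T U : cospan X Y)
    (f : cospan_map S T) (g : cospan_map T U) : cospan_map S U.
Proof.
  exists (f ;; g); rewrite comp_assoc.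
  - now rewrite !cmap_l.
  - now rewrite !cmap_r.
Defined.

Definition cmap_inverse (X Y : C) (S T : cospan X Y)
    (f : cospan_map S T) (g : cospan_map T S) : Prop :=
  f ;; g = idm S /\ g ;; f = idm T.

Lemma cmap_inverse_sym (X Y : C) (S T : cospan X Y)
    (f : cospan_map S T) (g : cospan_map T S) : cmap_inverse f g -> cmap_inverse g f.
Proof. intros []; now split. Qed.

Lemma id_cmap_inverse (X Y : C) (S : cospan X Y) : cmap_inverse (id_cmap S) (id_cmap S).
Proof. split; apply comp_idl. Qed.

Lemma span_iso_intro (X Y : C) (L S : cospan X Y) (s t : span_of_cospans L S)
    (f : cospan_map s t) (g : cospan_map t s) :
  cmap_inverse f g -> f ;; leg_l t = leg_l s -> f ;; leg_r t = leg_r s -> span_iso s t.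
Proof. intros Hfg e1 e2. exists f. split; [now split|]. now exists g. Qed.

(** The inverse inside [span_iso] is a bare morphism of [C]; as the inverse of a map of cospans it
    automatically commutes with the feet. *)
Lemma span_iso_elim (X Y : C) (L S : cospan X Y) (s t : span_of_cospans L S) :
  span_iso s t ->
  exists (f : cospan_map s t) (g : cospan_map t s),
    cmap_inverse f g /\ f ;; leg_l t = leg_l s /\ f ;; leg_r t = leg_r s.
Proof.
  intros (f & [e1 e2] & g & Hfg & Hgf). exists f.
  assert (gl : ft_l t ;; g = ft_l s) by now rewrite <- (cmap_l f), <- comp_assoc, Hfg, comp_idr.
  assert (gr : ft_r t ;; g = ft_r s) by now rewrite <- (cmap_r f), <- comp_assoc, Hfg, comp_idr.
  now exists (CospanMap gl gr).
Qed.

(** Legs with the same underlying morphism may carry different commutation proofs; the identity of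
    [M] is an isomorphism between the two spans. *)
Lemma span_iso_eq (X Y : C) (L S : cospan X Y) (M : cospan X Y)
    (l l' : cospan_map M L) (r r' : cospan_map M S) :
  l = l' :> hom M L -> r = r' :> hom M S ->
  span_iso (SpanOfCospans l r) (SpanOfCospans l' r').
Proof.
  intros el er.
  apply (span_iso_intro (s := SpanOfCospans l r) (t := SpanOfCospans l' r')
    (id_cmap_inverse M)); cbn; now rewrite comp_idl.
Qed.

Lemma span_iso_refl (X Y : C) (L S : cospan X Y) (s : span_of_cospans L S) : span_iso s s.
Proof. destruct s. now apply span_iso_eq. Qed.

Lemma span_iso_sym (X Y : C) (L S : cospan X Y) (s t : span_of_cospans L S) :
  span_iso s t -> span_iso t s.
Proof.
  intros H. destruct (span_iso_elim H) as (f & g & [Hfg Hgf] & e1 & e2).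
  apply (span_iso_intro (f := g) (g := f)); [now split| |].
  - now rewrite <- e1, comp_assoc, Hgf, comp_idl.
  - now rewrite <- e2, comp_assoc, Hgf, comp_idl.
Qed.

Lemma span_iso_trans (X Y : C) (L S : cospan X Y) (s t u : span_of_cospans L S) :
  span_iso s t -> span_iso t u -> span_iso s u.
Proof.
  intros H H'. destruct (span_iso_elim H) as (f & g & [Hfg Hgf] & e1 & e2).
  destruct (span_iso_elim H') as (f' & g' & [Hfg' Hgf'] & e1' & e2').
  apply (span_iso_intro (f := cmap_comp f f') (g := cmap_comp g' g)); [split| |]; cbn.
  - now rewrite comp_assoc, <- (comp_assoc f), Hfg', comp_idr.
  - now rewrite comp_assoc, <- (comp_assoc g'), Hgf, comp_idr.
  - now rewrite <- comp_assoc, e1'.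
  - now rewrite <- comp_assoc, e2'.
Qed.

Lemma mcell_rep (X Y : C) (L S : cospan X Y) (a : mcell L S) :
  exists s, monic_legs s /\ a s.
Proof.
  destruct (mcellP a) as (s & Hs & e). exists s. split; [exact Hs|].
  rewrite e. apply span_iso_refl.
Qed.

Lemma mcell_iso (X Y : C) (L S : cospan X Y) (a : mcell L S) (s t : span_of_cospans L S) :
  a s -> (span_iso s t <-> a t).
Proof.
  destruct (mcellP a) as (s0 & _ & ->). intros Hs. split; intros Ht.
  - now apply span_iso_trans with s.
  - apply span_iso_trans with s0; trivial. now apply span_iso_sym.
Qed.

(** Isomorphism classes that meet coincide. Equations between 2-cells are thus proved by exhibiting
    a common span. *)
Lemma mcell_eq (X Y : C) (L S : cospan X Y) (a b : mcell L S) (s : span_of_cospans L S) :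
  a s -> b s -> a = b.
Proof.
  intros Ha Hb.
  assert (e : in_mcell a = in_mcell b).
  { apply functional_extensionality. intros t. apply propositional_extensionality.
    now rewrite <- (mcell_iso _ Ha), (mcell_iso _ Hb). }
  destruct a as [A HA], b as [B HB]. cbn in e. subst B. f_equal. apply proof_irrelevance.
Qed.

Definition span_class (X Y : C) (L S : cospan X Y) (s : span_of_cospans L S)
    (Hs : monic_legs s) : mcell L S :=
  MCell (ex_intro _ s (conj Hs eq_refl)).

Definition graph (X Y : C) (L S : cospan X Y) (f : cospan_map L S) : span_of_cospans L S :=
  SpanOfCospans (id_cmap L) f.

Lemma graph_monic (X Y : C) (L S : cospan X Y) (f : cospan_map L S) (g : cospan_map S L) :
  cmap_inverse f g -> monic_legs (graph f).
Proof.
  intros [Hfg _]. split; cbn.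
  - now apply (monic_split (g := idm L)), comp_idl.
  - exact (monic_split Hfg).
Qed.

Definition span_precomp (X Y : C) (L L' S : cospan X Y)
    (g : cospan_map L' L) (s : span_of_cospans L' S) : span_of_cospans L S :=
  SpanOfCospans (cmap_comp (leg_l s) g) (leg_r s).

Definition span_postcomp (X Y : C) (L S S' : cospan X Y)
    (s : span_of_cospans L S) (f : cospan_map S S') : span_of_cospans L S' :=
  SpanOfCospans (leg_l s) (cmap_comp (leg_r s) f).

(** Pulling back along the isomorphism [f] keeps the apex of [s]; the projection to [L] is the left
    leg of [s] followed by the inverse of [f]. *)
Lemma graph_vcomposite_l (X Y : C) (L L' S : cospan X Y)
    (f : cospan_map L L') (g : cospan_map L' L) (s : span_of_cospans L' S) :
  cmap_inverse f g -> is_vcomposite (graph f) s (span_precomp g s).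
Proof.
  intros [Hfg Hgf]. exists (cmap_comp (leg_l s) g), (id_cmap s). cbn. split; [split|].
  - now rewrite <- comp_assoc, Hgf, comp_idl, comp_idr.
  - intros W h k e. exists k. split.
    + now rewrite comp_idr, comp_assoc, <- e, <- comp_assoc, Hfg, comp_idr.
    + intros k' [_ <-]. now rewrite comp_idr.
  - now rewrite comp_idl, comp_idr.
Qed.

Lemma graph_vcomposite_r (X Y : C) (L S S' : cospan X Y)
    (s : span_of_cospans L S) (f : cospan_map S S') :
  is_vcomposite s (graph f) (span_postcomp s f).
Proof.
  exists (id_cmap s), (leg_r s). cbn. split; [split|].
  - now rewrite comp_idl, comp_idr.
  - intros W h k e. exists h. split.
    + now rewrite e, !comp_idr.
    + intros h' [<- _]. now rewrite comp_idr.
  - now rewrite comp_idl.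
Qed.

Lemma vcomposite_exists (HC : is_topos C) (X Y : C) (L S L' : cospan X Y)
    (s : span_of_cospans L S) (t : span_of_cospans S L') :
  exists u, is_vcomposite s t u.
Proof.
  destruct (topos_pullbacks HC (leg_r s) (leg_l t)) as (P & p1 & p2 & Hpb).
  destruct (proj2 Hpb X (ft_l s) (ft_l t)) as (x & [x1 x2] & _); [now rewrite !cmap_l|].
  destruct (proj2 Hpb Y (ft_r s) (ft_r t)) as (y & [y1 y2] & _); [now rewrite !cmap_r|].
  set (q1 := CospanMap (S := Cospan x y) (T := mid s) x1 y1).
  set (q2 := CospanMap (S := Cospan x y) (T := mid t) x2 y2).
  exists (SpanOfCospans (cmap_comp q1 (leg_l s)) (cmap_comp q2 (leg_r t))).
  now exists q1, q2.
Qed.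

Lemma vcomposite_monic (X Y : C) (L S L' : cospan X Y)
    (s : span_of_cospans L S) (t : span_of_cospans S L') (u : span_of_cospans L L') :
  is_vcomposite s t u -> monic_legs s -> monic_legs t -> monic_legs u.
Proof.
  intros (p1 & p2 & Hpb & e1 & e2) [Hs1 Hs2] [Ht1 Ht2].
  split; [rewrite e1|rewrite e2]; apply monic_comp; trivial.
  - exact (pullback_monic_l Hpb Ht1).
  - exact (pullback_monic_r Hpb Hs2).
Qed.

(** Makes vertical composition well defined on classes, whatever pullbacks are chosen. *)
Lemma vcomposite_iso (X Y : C) (L S L' : cospan X Y)
    (s s' : span_of_cospans L S) (t t' : span_of_cospans S L') (u u' : span_of_cospans L L') :
  span_iso s s' -> span_iso t t' -> is_vcomposite s t u -> is_vcomposite s' t' u' ->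
  span_iso u u'.
Proof.
  intros Hs Ht (p1 & p2 & Hpb & el & er) (p1' & p2' & Hpb' & el' & er').
  destruct (span_iso_elim Hs) as (f & f' & [Hff' Hf'f] & f1 & f2).
  destruct (span_iso_elim Ht) as (g & g' & [Hgg' Hg'g] & g1 & g2).
  destruct (proj2 Hpb' u (p1 ;; f) (p2 ;; g)) as (h & [h1 h2] & _).
  { rewrite <- !comp_assoc, f2, g1. apply Hpb. }
  destruct (proj2 Hpb u' (p1' ;; f') (p2' ;; g')) as (k & [k1 k2] & _).
  { rewrite <- f2, <- g1, <- !comp_assoc, !(comp_assoc f'), !(comp_assoc g').
    rewrite Hf'f, Hg'g, !comp_idl. apply Hpb'. }
  assert (hl : ft_l u ;; h = ft_l u').
  { apply (pullback_jointly_monic Hpb').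
    - now rewrite <- comp_assoc, h1, comp_assoc, !cmap_l.
    - now rewrite <- comp_assoc, h2, comp_assoc, !cmap_l. }
  assert (hr : ft_r u ;; h = ft_r u').
  { apply (pullback_jointly_monic Hpb').
    - now rewrite <- comp_assoc, h1, comp_assoc, !cmap_r.
    - now rewrite <- comp_assoc, h2, comp_assoc, !cmap_r. }
  exists (CospanMap hl hr). split; [split|exists k; split]; cbn.
  - now rewrite el', el, comp_assoc, h1, <- comp_assoc, f1.
  - now rewrite er', er, comp_assoc, h2, <- comp_assoc, g2.
  - apply (pullback_jointly_monic Hpb); rewrite <- comp_assoc, ?k1, ?k2, comp_assoc, ?h1, ?h2;
      now rewrite <- comp_assoc, ?Hff', ?Hgg', comp_idl, comp_idr.
  - apply (pullback_jointly_monic Hpb'); rewrite <- comp_assoc, ?h1, ?h2, comp_assoc, ?k1, ?k2;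
      now rewrite <- comp_assoc, ?Hf'f, ?Hg'g, comp_idl, comp_idr.
Qed.

(** Both composites have as apex the pullback of the two binary pullbacks over [t]. *)
Lemma vcomposite_assoc (HC : is_topos C) (X Y : C) (L S S' L' : cospan X Y)
    (s : span_of_cospans L S) (t : span_of_cospans S S') (r : span_of_cospans S' L') :
  exists st tr u, is_vcomposite s t st /\ is_vcomposite t r tr /\
    is_vcomposite s tr u /\ is_vcomposite st r u.
Proof.
  destruct (vcomposite_exists HC s t) as (st & Hst).
  destruct (vcomposite_exists HC t r) as (tr & Htr).
  exists st, tr.
  pose proof Hst as (p1 & p2 & [sq H] & el & er).
  pose proof Htr as (q1 & q2 & [sq' H'] & el' & er').
  (* Regarding [p2] and [q1] as inner legs yields their pullback over [t] together with its feet.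
     Pasting pullbacks on either side then gives the two bracketings. *)
  destruct (vcomposite_exists HC (SpanOfCospans (leg_l st) p2) (SpanOfCospans q1 (leg_r tr)))
    as (u & w1 & w2 & [sqw Hw] & elw & erw). cbn in *.
  exists u. split; [exact Hst|]. split; [exact Htr|]. split.
  - exists (cmap_comp w1 p1), w2. cbn. split; [split|].
    + now rewrite el', <- comp_assoc, sq, !comp_assoc, sqw.
    + intros W h k e.
      destruct (H W h (k ;; q1)) as (v & [v1 v2] & _); [now rewrite e, el', comp_assoc|].
      destruct (Hw W v k v2) as (z & [z1 z2] & Hz).
      exists z. split; [now rewrite comp_assoc, z1|].
      intros z' [e1 e2]. apply Hz. split; trivial.
      apply (pullback_jointly_monic (conj sq H)).
      * now rewrite v1, <- comp_assoc.
      * now rewrite v2, <- e2, <- !comp_assoc, sqw.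
    + split; [now rewrite elw, el, comp_assoc|exact erw].
  - exists w1, (cmap_comp w2 q2). cbn. split; [split|].
    + now rewrite er, <- comp_assoc, <- sq', !comp_assoc, sqw.
    + intros W h k e.
      destruct (H' W (h ;; p2) k) as (v & [v1 v2] & _); [now rewrite <- e, er, comp_assoc|].
      destruct (Hw W h v (eq_sym v1)) as (z & [z1 z2] & Hz).
      exists z. split; [now rewrite comp_assoc, z2|].
      intros z' [e1 e2]. apply Hz. split; trivial.
      apply (pullback_jointly_monic (conj sq' H')).
      * now rewrite v1, <- e1, <- !comp_assoc, sqw.
      * now rewrite v2, <- comp_assoc.
    + split; [exact elw|now rewrite erw, er', comp_assoc].
Qed.

End SpanCells.

(** * Associator and unitor maps of cospans *)

Lemma po_med_l_assoc (C : category) (po : chosen_pushouts C) (U V W Z Z' : C)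
    (f : hom V U) (g : hom V W) (h : hom U Z) (k : hom W Z) (e : f ;; h = g ;; k) (x : hom Z Z') :
  po_l po f g ;; (po_med po e ;; x) = h ;; x.
Proof. now rewrite comp_assoc, po_med_l. Qed.

Lemma po_med_r_assoc (C : category) (po : chosen_pushouts C) (U V W Z Z' : C)
    (f : hom V U) (g : hom V W) (h : hom U Z) (k : hom W Z) (e : f ;; h = g ;; k) (x : hom Z Z') :
  po_r po f g ;; (po_med po e ;; x) = k ;; x.
Proof. now rewrite comp_assoc, po_med_r. Qed.

(** Nesting composites to the right puts each coprojection next to the mediating map that it
    cancels; the [_assoc] variants handle mediating maps followed by further factors. *)
Ltac po_simpl :=
  cbn;
  repeat first [ rewrite <- comp_assoc | rewrite comp_idl | rewrite comp_idr
               | rewrite po_med_l | rewrite po_med_r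
               | rewrite po_med_l_assoc | rewrite po_med_r_assoc ].

Section Coherence.
Variables (C : category) (po : chosen_pushouts C).

Lemma po_map_id (X Y Z : C) (S : cospan X Y) (T : cospan Y Z) :
  po_map po (id_cmap S) (id_cmap T) = idm _ :> hom (cospan_comp po S T) (cospan_comp po S T).
Proof. apply po_ext; now po_simpl. Qed.

Lemma po_map_comp (X Y Z : C) (S S' S'' : cospan X Y) (T T' T'' : cospan Y Z)
    (f : cospan_map S S') (f' : cospan_map S' S'') (g : cospan_map T T') (g' : cospan_map T' T'')
    (h : cospan_map S S'') (k : cospan_map T T'') :
  h = f ;; f' :> hom S S'' -> k = g ;; g' :> hom T T'' ->
  po_map po h k = po_map po f g ;; po_map po f' g'
    :> hom (cospan_comp po S T) (cospan_comp po S'' T'').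
Proof. intros e e'. apply po_ext; po_simpl; now rewrite ?e, ?e', comp_assoc. Qed.

Lemma po_map_inverse (X Y Z : C) (S S' : cospan X Y) (T T' : cospan Y Z)
    (f : cospan_map S S') (f' : cospan_map S' S) (g : cospan_map T T') (g' : cospan_map T' T) :
  cmap_inverse f f' -> cmap_inverse g g' -> cmap_inverse (po_map po f g) (po_map po f' g').
Proof.
  intros [Hf Hf'] [Hg Hg']. split.
  - rewrite <- po_map_id. symmetry. now apply po_map_comp.
  - rewrite <- po_map_id. symmetry. now apply po_map_comp.
Qed.

Section Associator.
Variables (W X Y Z : C) (R : cospan W X) (S : cospan X Y) (T : cospan Y Z).
Local Notation RS := (cospan_comp po R S).
Local Notation ST := (cospan_comp po S T).

Lemma assoc_sq_inner :
  ft_r R ;; po_l po (ft_r R) (ft_l ST)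
  = ft_l S ;; (po_l po (ft_r S) (ft_l T) ;; po_r po (ft_r R) (ft_l ST)).
Proof. rewrite comp_assoc. apply po_sq. Qed.

Lemma assoc_sq :
  ft_r RS ;; po_med po assoc_sq_inner
  = ft_l T ;; (po_r po (ft_r S) (ft_l T) ;; po_r po (ft_r R) (ft_l ST)).
Proof. po_simpl. now rewrite !comp_assoc, po_sq. Qed.

Definition assoc_map :
  cospan_map (cospan_comp po RS T) (cospan_comp po R ST).
Proof. exists (po_med po assoc_sq); po_simpl; reflexivity. Defined.

Lemma assoc_inv_sq_inner :
  ft_r S ;; (po_r po (ft_r R) (ft_l S) ;; po_l po (ft_r RS) (ft_l T))
  = ft_l T ;; po_r po (ft_r RS) (ft_l T).
Proof. rewrite comp_assoc. apply po_sq. Qed.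

Lemma assoc_inv_sq :
  ft_r R ;; (po_l po (ft_r R) (ft_l S) ;; po_l po (ft_r RS) (ft_l T))
  = ft_l ST ;; po_med po assoc_inv_sq_inner.
Proof. po_simpl. now rewrite !comp_assoc, po_sq. Qed.

Definition assoc_inv :
  cospan_map (cospan_comp po R ST) (cospan_comp po RS T).
Proof. exists (po_med po assoc_inv_sq); po_simpl; reflexivity. Defined.

Lemma assoc_inverse : cmap_inverse assoc_map assoc_inv.
Proof. split; repeat apply po_ext; now po_simpl. Qed.

Lemma assoc_iterated_pushout :
  is_iterated_pushout (R := R) (S := S) (T := T)
    (po_l po (ft_r R) (ft_l S) ;; po_l po (ft_r RS) (ft_l T))
    (po_r po (ft_r R) (ft_l S) ;; po_l po (ft_r RS) (ft_l T))
    (po_r po (ft_r RS) (ft_l T)).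
Proof.
  split; [now rewrite !comp_assoc, po_sq|]. split; [apply assoc_inv_sq_inner|].
  intros Q jR jS jT e1 e2.
  assert (e : ft_r RS ;; po_med po e1 = ft_l T ;; jT) by now po_simpl.
  exists (po_med po e). split; [now po_simpl|].
  intros u (u1 & u2 & u3). repeat apply po_ext; po_simpl; now rewrite ?comp_assoc.
Qed.

Lemma assoc_graph : is_associator_span (graph assoc_map).
Proof.
  eexists _, _, _. split; [exact assoc_iterated_pushout|]. cbn.
  repeat split; now po_simpl.
Qed.

(** The apex of [u] may be any iterated pushout. As the left leg of the graph is an identity, the
    isomorphism to the graph is the left leg of [u] itself, inverted by the universal property. *)
Lemma associator_span_iso (u : span_of_cospans (cospan_comp po RS T) (cospan_comp po R ST)) :
  is_associator_span u -> span_iso (graph assoc_map) u.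
Proof.
  intros (iR & iS & iT & (e1 & e2 & Hu) & eL & eR & l1 & l2 & l3 & r1 & r2 & r3).
  apply span_iso_sym.
  destruct (proj2 (proj2 assoc_iterated_pushout) u iR iS iT e1 e2) as (g & (g1 & g2 & g3) & _).
  exists (leg_l u). split; [split|exists g; split]; cbn in *.
  - apply comp_idr.
  - destruct (Hu _ (iR ;; leg_r u) (iS ;; leg_r u) (iT ;; leg_r u)) as (x & _ & Hx).
    { now rewrite !comp_assoc, e1. } { now rewrite !comp_assoc, e2. }
    transitivity x; [symmetry|]; apply Hx; [|auto].
    cbn. rewrite !comp_assoc, l1, l2, l3, r1, r2, r3. repeat split; now po_simpl.
  - destruct (Hu _ iR iS iT e1 e2) as (x & _ & Hx).
    transitivity x; [symmetry|]; apply Hx; rewrite ?comp_idr; auto.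
    now rewrite !comp_assoc, l1, l2, l3.
  - repeat apply po_ext; rewrite comp_idr, !comp_assoc, ?g1, ?g2, ?g3; now rewrite <- ?comp_assoc.
Qed.

End Associator.

Section Unitors.
Variables (X Y : C) (S : cospan X Y).

Lemma runitor_sq : ft_r S ;; idm S = ft_l (id_cospan Y) ;; ft_r S.
Proof. cbn. now rewrite comp_idl, comp_idr. Qed.

Definition runitor_map : cospan_map (cospan_comp po S (id_cospan Y)) S.
Proof. exists (po_med po runitor_sq); now po_simpl. Defined.

Definition runitor_inv : cospan_map S (cospan_comp po S (id_cospan Y)) :=
  leg_l (runitor_span po S).

Lemma runitor_inverse : cmap_inverse runitor_map runitor_inv.
Proof.
  split; [|cbn; now rewrite po_med_l].
  apply po_ext; po_simpl; trivial. rewrite po_sq. now po_simpl.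
Qed.

(** The prescribed unitor has apex [S], the graph has apex [S +_Y Y]; the coprojection of [S]
    identifies the two. *)
Lemma runitor_graph : span_iso (runitor_span po S) (graph runitor_map).
Proof.
  apply (span_iso_intro (s := runitor_span po S) (t := graph runitor_map)
    (cmap_inverse_sym runitor_inverse)); now po_simpl.
Qed.

Lemma lunitor_sq : ft_r (id_cospan X) ;; ft_l S = ft_l S ;; idm S.
Proof. cbn. now rewrite comp_idl, comp_idr. Qed.

Definition lunitor_map : cospan_map (cospan_comp po (id_cospan X) S) S.
Proof. exists (po_med po lunitor_sq); now po_simpl. Defined.

Definition lunitor_inv : cospan_map S (cospan_comp po (id_cospan X) S) :=
  leg_l (lunitor_span po S).

Lemma lunitor_inverse : cmap_inverse lunitor_map lunitor_inv.
Proof.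
  split; [|cbn; now rewrite po_med_r].
  apply po_ext; po_simpl; trivial. rewrite <- po_sq. now po_simpl.
Qed.

Lemma lunitor_graph : span_iso (lunitor_span po S) (graph lunitor_map).
Proof.
  apply (span_iso_intro (s := lunitor_span po S) (t := graph lunitor_map)
    (cmap_inverse_sym lunitor_inverse)); now po_simpl.
Qed.

End Unitors.
End Coherence.

(** * Horizontal composition and existence of the operations *)

Section HorizontalComposition.
Variables (C : category) (HC : is_topos C) (po : chosen_pushouts C).

Lemma span_hcomp_monic (X Y Z : C) (L S : cospan X Y) (R T : cospan Y Z)
    (s : span_of_cospans L S) (t : span_of_cospans R T) :
  monic_legs s -> monic_legs t -> monic_legs (span_hcomp po s t).
Proof.
  intros [Hsl Hsr] [Htl Htr]. split.
  - refine (pushout_map_monic HC Hsl Htl (cmap_r _) (cmap_l _) _ _); now po_simpl.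
  - refine (pushout_map_monic HC Hsr Htr (cmap_r _) (cmap_l _) _ _); now po_simpl.
Qed.

Lemma span_hcomp_iso (X Y Z : C) (L S : cospan X Y) (R T : cospan Y Z)
    (s s' : span_of_cospans L S) (t t' : span_of_cospans R T) :
  span_iso s s' -> span_iso t t' -> span_iso (span_hcomp po s t) (span_hcomp po s' t').
Proof.
  intros Hs Ht.
  destruct (span_iso_elim Hs) as (f & f' & Hf & f1 & f2).
  destruct (span_iso_elim Ht) as (g & g' & Hg & g1 & g2).
  refine (span_iso_intro (s := span_hcomp po s t) (t := span_hcomp po s' t')
    (po_map_inverse po Hf Hg) _ _); symmetry; apply po_map_comp; auto.
Qed.

(** The interchange law on representatives. The apices of [u] and [v] are intersections of
    subobjects of [S] and of [T], so [pushout_map_pullback] applies. *)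
Lemma span_hcomp_vcomposite (X Y Z : C) (L S S' : cospan X Y) (R T T' : cospan Y Z)
    (s : span_of_cospans L S) (s' : span_of_cospans S S') (u : span_of_cospans L S')
    (t : span_of_cospans R T) (t' : span_of_cospans T T') (v : span_of_cospans R T') :
  monic_legs s -> monic_legs s' -> monic_legs t -> monic_legs t' ->
  is_vcomposite s s' u -> is_vcomposite t t' v ->
  is_vcomposite (span_hcomp po s t) (span_hcomp po s' t') (span_hcomp po u v).
Proof.
  intros [_ Hs] [Hs' _] [_ Ht] [Ht' _].
  intros (p1 & p2 & Hp & ep1 & ep2) (q1 & q2 & Hq & eq1 & eq2).
  exists (po_map po p1 q1), (po_map po p2 q2). split; [|split; now apply po_map_comp].
  refine (pushout_map_pullback HC Hs Hs' Ht Ht' (cmap_r _) (cmap_l _) (cmap_r _) (cmap_l _)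
    (cmap_r p1) (cmap_l q1) Hp Hq _ _ _ _ _ _ _ _); now po_simpl.
Qed.

Lemma span_hcomp_graph (X Y Z : C) (S S' : cospan X Y) (T T' : cospan Y Z)
    (f : cospan_map S S') (g : cospan_map T T') :
  span_iso (span_hcomp po (graph f) (graph g)) (graph (po_map po f g)).
Proof. apply span_iso_eq; [apply po_map_id|reflexivity]. Qed.

Lemma operations_exist : inhabited (MonSpCsp_operations po).
Proof.
  (* The operations act on chosen representatives and chosen vertical composites. Their
     specifications for all other spans follow from invariance under isomorphism. *)
  set (rep := fun (X Y : C) (L S : cospan X Y) (a : mcell L S) =>
    constructive_indefinite_description _ (mcell_rep a)).
  set (vc := fun (X Y : C) (L S L' : cospan X Y) (a : mcell L S) (b : mcell S L') =>
    constructive_indefinite_description _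
      (vcomposite_exists HC (proj1_sig (rep _ _ _ _ a)) (proj1_sig (rep _ _ _ _ b)))).
  assert (Hvc : forall X Y L S L' a b, monic_legs (proj1_sig (vc X Y L S L' a b))).
  { intros. refine (vcomposite_monic (proj2_sig (vc _ _ _ _ _ _ _)) _ _);
      apply (proj2_sig (rep _ _ _ _ _)). }
  assert (Hiso : forall X Y (L S : cospan X Y) (a : mcell L S) s,
    a s -> span_iso (proj1_sig (rep X Y L S a)) s).
  { intros X Y L S a s Hs. refine (proj2 (mcell_iso _ _) Hs).
    apply (proj2_sig (rep _ _ _ _ _)). }
  constructor. unshelve econstructor.
  - intros X Y S. exact (span_class (graph_monic (id_cmap_inverse S))).
  - intros X Y L S L' a b. exact (span_class (Hvc X Y L S L' a b)).
  - intros X Y Z L S R T a b. exact (span_class (span_hcomp_monic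
      (proj1 (proj2_sig (rep _ _ _ _ a))) (proj1 (proj2_sig (rep _ _ _ _ b))))).
  - intros W X Y Z R S T. exact (span_class (graph_monic (assoc_inverse po R S T))).
  - intros X Y S. exact (span_class (graph_monic (lunitor_inverse po S))).
  - intros X Y S. exact (span_class (graph_monic (runitor_inverse po S))).
  - intros. apply span_iso_refl.
  - intros X Y L S L' a b s t u Hs Ht Hu.
    exact (vcomposite_iso (Hiso _ _ _ _ _ _ Hs) (Hiso _ _ _ _ _ _ Ht)
      (proj2_sig (vc _ _ _ _ _ _ _)) Hu).
  - intros. apply span_hcomp_iso; now apply Hiso.
  - intros. now apply associator_span_iso.
  - intros. apply span_iso_sym, lunitor_graph.
  - intros. apply span_iso_sym, runitor_graph.
Qed.

End HorizontalComposition.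

(** * The bicategory laws *)

Section Laws.
Variables (C : category) (HC : is_topos C) (po : chosen_pushouts C).
Variable D : MonSpCsp_operations po.

Lemma massociator_graph (W X Y Z : C) (R : cospan W X) (S : cospan X Y) (T : cospan Y Z) :
  massociator D R S T (graph (assoc_map po R S T)).
Proof. apply massociatorP, assoc_graph. Qed.

Lemma mlunitor_graph (X Y : C) (S : cospan X Y) : mlunitor D S (graph (lunitor_map po S)).
Proof. apply (mcell_iso _ (mlunitorP D S)), lunitor_graph. Qed.

Lemma mrunitor_graph (X Y : C) (S : cospan X Y) : mrunitor D S (graph (runitor_map po S)).
Proof. apply (mcell_iso _ (mrunitorP D S)), runitor_graph. Qed.

Lemma mid2_graph (X Y : C) (S : cospan X Y) : mid2 D S (graph (id_cmap S)).
Proof. exact (mid2P D S). Qed.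

Lemma mvcomp_graph (X Y : C) (L S T : cospan X Y) (a : mcell L S) (b : mcell S T)
    (f : cospan_map L S) (g : cospan_map S T) :
  a (graph f) -> b (graph g) -> mvcomp D a b (graph (cmap_comp f g)).
Proof. intros Ha Hb. apply (mvcompP D Ha Hb). apply (graph_vcomposite_r (graph f) g). Qed.

Lemma mhcomp_graph (X Y Z : C) (S S' : cospan X Y) (T T' : cospan Y Z)
    (a : mcell S S') (b : mcell T T') (f : cospan_map S S') (g : cospan_map T T') :
  a (graph f) -> b (graph g) -> mhcomp D a b (graph (po_map po f g)).
Proof.
  intros Ha Hb. apply (mcell_iso _ (mhcompP D Ha Hb)), span_hcomp_graph.
Qed.

(** Reduces laws between 2-cells represented by graphs, such as the pentagon and the triangle, to
    equations between morphisms of [C]. *)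
Lemma mcell_graph_eq (X Y : C) (L S : cospan X Y) (a b : mcell L S) (f g : cospan_map L S) :
  a (graph f) -> b (graph g) -> f = g :> hom L S -> a = b.
Proof.
  intros Ha Hb e. apply mcell_eq with (graph f); trivial.
  apply (mcell_iso _ Hb). now apply span_iso_eq.
Qed.

Lemma graph_invertible (X Y : C) (L S : cospan X Y) (a : mcell L S)
    (f : cospan_map L S) (g : cospan_map S L) :
  a (graph f) -> cmap_inverse f g -> invertible2 (B := MonSpCsp D) a.
Proof.
  intros Ha Hfg.
  pose (b := span_class (graph_monic (cmap_inverse_sym Hfg))).
  assert (Hb : b (graph g)) by apply span_iso_refl.
  exists b. split; eapply mcell_graph_eq.
  - exact (mvcomp_graph Ha Hb).
  - apply mid2_graph.
  - apply Hfg.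
  - exact (mvcomp_graph Hb Ha).
  - apply mid2_graph.
  - apply Hfg.
Qed.

(** Composing with the graphs keeps the apices of [s] and [t], so an isomorphism [h] of apices over
    [f] and [f'] identifies the two sides of the naturality square. *)
Lemma graph_natural (X Y : C) (L L' S S' : cospan X Y)
    (a : mcell L S) (b : mcell L' S') (c : mcell L L') (c' : mcell S S')
    (s : span_of_cospans L S) (t : span_of_cospans L' S')
    (f : cospan_map L L') (g : cospan_map L' L) (f' : cospan_map S S')
    (h : cospan_map s t) (k : cospan_map t s) :
  a s -> b t -> c (graph f) -> c' (graph f') -> cmap_inverse f g -> cmap_inverse h k ->
  h ;; leg_l t = leg_l s ;; f -> h ;; leg_r t = leg_r s ;; f' ->
  mvcomp D a c' = mvcomp D c b.
Proof.
  intros Ha Hb Hc Hc' Hfg Hhk e e'.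
  apply mcell_eq with (span_postcomp s f').
  - exact (mvcompP D Ha Hc' (graph_vcomposite_r s f')).
  - apply (mcell_iso _ (mvcompP D Hc Hb (graph_vcomposite_l t Hfg))).
    apply span_iso_sym.
    apply (span_iso_intro (s := span_postcomp s f') (t := span_precomp g t) Hhk);
      cbn; trivial.
    destruct Hfg as [Hfg _].
    now rewrite comp_assoc, e, <- comp_assoc, Hfg, comp_idr.
Qed.

Lemma MonSpCsp_is_bicategory : is_bicategory (MonSpCsp D).
Proof.
  constructor; cbn.
  - intros X Y f g a. destruct (mcell_rep a) as (s & _ & Hs).
    apply mcell_eq with s; trivial.
    apply (mcell_iso _ (mvcompP D (mid2P D f) Hs (graph_vcomposite_l s (id_cmap_inverse f)))).
    destruct s. apply span_iso_eq; trivial. apply comp_idr.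
  - intros X Y f g a. destruct (mcell_rep a) as (s & _ & Hs).
    apply mcell_eq with s; trivial.
    apply (mcell_iso _ (mvcompP D Hs (mid2P D g) (graph_vcomposite_r s (id_cmap g)))).
    destruct s. apply span_iso_eq; trivial. apply comp_idr.
  - intros X Y f g h k a b c.
    destruct (mcell_rep a) as (s & _ & Hs), (mcell_rep b) as (t & _ & Ht),
      (mcell_rep c) as (r & _ & Hr).
    destruct (vcomposite_assoc HC s t r) as (st & tr & u & Hst & Htr & Hu & Hu').
    apply mcell_eq with u.
    + exact (mvcompP D Hs (mvcompP D Ht Hr Htr) Hu).
    + exact (mvcompP D (mvcompP D Hs Ht Hst) Hr Hu').
  - intros X Y Z f g. eapply mcell_graph_eq.
    + apply mhcomp_graph; apply mid2_graph.
    + apply mid2_graph.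
    + apply po_map_id.
  - intros X Y Z f f' f'' g g' g'' a a' b b'.
    destruct (mcell_rep a) as (s & Hs & Has), (mcell_rep a') as (s' & Hs' & Has'),
      (mcell_rep b) as (t & Ht & Hbt), (mcell_rep b') as (t' & Ht' & Hbt').
    destruct (vcomposite_exists HC s s') as (u & Hu), (vcomposite_exists HC t t') as (v & Hv).
    apply mcell_eq with (span_hcomp po u v).
    + exact (mhcompP D (mvcompP D Has Has' Hu) (mvcompP D Hbt Hbt' Hv)).
    + apply (mvcompP D (mhcompP D Has Hbt) (mhcompP D Has' Hbt')).
      now apply span_hcomp_vcomposite.
  - intros W X Y Z f f' g g' h h' a b c.
    destruct (mcell_rep a) as (s & _ & Hs), (mcell_rep b) as (t & _ & Ht),
      (mcell_rep c) as (r & _ & Hr).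
    (* The isomorphism of apices is the associator map of the middle cospans [s], [t], [r]. *)
    apply (graph_natural (mhcompP D (mhcompP D Hs Ht) Hr) (mhcompP D Hs (mhcompP D Ht Hr))
      (massociator_graph f g h) (massociator_graph f' g' h')
      (assoc_inverse po f g h) (assoc_inverse po s t r));
      repeat apply po_ext; now po_simpl.
  - intros W X Y Z f g h.
    exact (graph_invertible (massociator_graph f g h) (assoc_inverse po f g h)).
  - intros X Y f g a. destruct (mcell_rep a) as (s & _ & Hs).
    apply (graph_natural (mhcompP D (mid2P D _) Hs) Hs (mlunitor_graph f) (mlunitor_graph g)
      (lunitor_inverse po f) (lunitor_inverse po s));
      repeat apply po_ext; po_simpl; rewrite ?cmap_l; trivial.
  - intros X Y f. exact (graph_invertible (mlunitor_graph f) (lunitor_inverse po f)).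
  - intros X Y f g a. destruct (mcell_rep a) as (s & _ & Hs).
    apply (graph_natural (mhcompP D Hs (mid2P D _)) Hs (mrunitor_graph f) (mrunitor_graph g)
      (runitor_inverse po f) (runitor_inverse po s));
      repeat apply po_ext; po_simpl; rewrite ?cmap_r; trivial.
  - intros X Y f. exact (graph_invertible (mrunitor_graph f) (runitor_inverse po f)).
  - intros V W X Y Z f g h k. eapply mcell_graph_eq.
    + apply mvcomp_graph; apply massociator_graph.
    + apply mvcomp_graph; [apply mvcomp_graph|].
      * apply mhcomp_graph; [apply massociator_graph|apply mid2_graph].
      * apply massociator_graph.
      * apply mhcomp_graph; [apply mid2_graph|apply massociator_graph].
    + repeat apply po_ext; now po_simpl.
  - intros X Y Z f g. eapply mcell_graph_eq.
    + apply mvcomp_graph; [apply massociator_graph|].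
      apply mhcomp_graph; [apply mid2_graph|apply mlunitor_graph].
    + apply mhcomp_graph; [apply mrunitor_graph|apply mid2_graph].
    (* What remains is the coprojection of the middle [Y]: one side enters the pushout through [g],
       the other through [f]. *)
    + repeat apply po_ext; po_simpl; trivial. symmetry. apply po_sq.
Qed.

End Laws.

Theorem theorem2p8 (C : category) (HC : is_topos C) (po : chosen_pushouts C) :
  inhabited (MonSpCsp_operations po) /\
  forall D : MonSpCsp_operations po, is_bicategory (MonSpCsp D).
Proof.
  split; [exact (operations_exist HC po)|].
  intros D. exact (MonSpCsp_is_bicategory HC D).
Qed.
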